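(* Let $A,\Delta A\in\mathbb{R}^{n\times m}$, $\widetilde A=A+\Delta A$ and $1\le r<\min\{n,m\}$. Then \[\max\{\|\sin\Theta(U_1,\widetilde U_1)\|,\|\sin\Theta(V_1,\widetilde V_1)\|\}\le\min\Big\{\frac{2\|\Delta A\|}{\sigma_r-\sigma_{r+1}},1\Big\},\] where the minimum is interpreted as $1$ when $\sigma_r=\sigma_{r+1}$. Moreover, if $4\|\Delta A\|\le\sigma_r-\sigma_{r+1}$, then \[\|\sin\Theta(U_1,\widetilde U_1)\|\le\frac{8}{3}\cdot\frac{\sigma_r\|\alpha_{21}\|+\sigma_{r+1}\|\alpha_{12}\|+\|\alpha_{22}\|\|\alpha_{12}\|}{\sigma_r^2-\sigma_{r+1}^2},\qquad \|\sin\Theta(V_1,\widetilde V_1)\|\le\frac{8}{3}\cdot\frac{\sigma_r\|\alpha_{12}\|+\sigma_{r+1}\|\alpha_{21}\|+\|\alpha_{22}\|\|\alpha_{21}\|}{\sigma_r^2-\sigma_{r+1}^2},\] where $\alpha_{12}=U_1^T(\Delta A)V_2$, $\alpha_{21}=U_2^T(\Delta A)V_1$, $\alpha_{22}=U_2^T(\Delta A)V_2$.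
   Context: $A=U\Sigma V^T$ and $\widetilde A=\widetilde U\widetilde\Sigma\widetilde V^T$ are full SVDs with singular values $\sigma_1\ge\sigma_2\ge\dots$ of $A$ in nonincreasing order. $U=(U_1\ U_2)$ with $U_1\in\mathbb{R}^{n\times r}$, $V=(V_1\ V_2)$ with $V_1\in\mathbb{R}^{m\times r}$, and likewise $\widetilde U_1\in\mathbb{R}^{n\times r},\widetilde V_1\in\mathbb{R}^{m\times r}$ hold the leading $r$ singular vectors of $\widetilde A$. $\|\cdot\|$ is the spectral norm. For $X,\widetilde X\in\mathbb{R}^{d\times r}$ with orthonormal columns, if $\zeta_1\ge\dots\ge\zeta_r$ are the singular values of $X^T\widetilde X$, then $\sin\Theta(X,\widetilde X)=\mathrm{diag}(\sqrt{1-\zeta_1^2},\dots,\sqrt{1-\zeta_r^2})$. *)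

(* Defs.v *)
From HB Require Import structures.
From mathcomp Require Import all_boot all_order all_algebra.
From mathcomp Require Import boolp classical_sets reals.
Set Implicit Arguments. Unset Strict Implicit. Unset Printing Implicit Defensive.
Import Order.TTheory GRing.Theory Num.Theory.
Local Open Scope ring_scope.

Section Defs.
Variable R : realType.

Definition mxe p q (M : 'M[R]_(p, q)) (i k : nat) : R :=
  match (insub i : option 'I_p), (insub k : option 'I_q) with
  | Some i', Some k' => M i' k'
  | _, _ => 0
  end.

Definition rdiag p q (M : 'M[R]_(p, q)) (k : nat) : R := mxe M k k.

Definition lcols d c (r : nat) (X : 'M[R]_(d, c)) : 'M[R]_(d, r) :=
  \matrix_(i < d, j < r) mxe X i j.
Definition rcols d c (r : nat) (X : 'M[R]_(d, c)) : 'M[R]_(d, c - r) :=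
  \matrix_(i < d, j < c - r) mxe X i (r + j).

Definition vnorm2 q (x : 'cV[R]_q) : R := Num.sqrt (\sum_i x i 0 ^+ 2).
Definition specnorm p q (M : 'M[R]_(p, q)) : R :=
  sup [set vnorm2 (M *m x) | x in [set x : 'cV[R]_q | vnorm2 x = 1]]%classic.

Definition is_svd p q (M : 'M[R]_(p, q)) (P : 'M[R]_p) (D : 'M[R]_(p, q))
    (Q : 'M[R]_q) : Prop :=
  [/\ P^T *m P = 1%:M, Q^T *m Q = 1%:M, M = P *m D *m Q^T,
      (forall (i : 'I_p) (j : 'I_q), (i : nat) != j -> D i j = 0) &
      ((forall k, (k < minn p q)%N -> 0 <= rdiag D k) /\
       (forall k l, (k <= l)%N -> (l < minn p q)%N -> rdiag D l <= rdiag D k))].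

Definition is_svals p q (M : 'M[R]_(p, q)) (s : nat -> R) : Prop :=
  exists P D Q, is_svd M P D Q /\
    (forall k, (k < minn p q)%N -> rdiag D k = s k).

(* The singular values of M (well defined: unique on indices < minn p q). *)
Definition svals p q (M : 'M[R]_(p, q)) : nat -> R :=
  match pselect (exists s, is_svals M s) with
  | left H => proj1_sig (cid H)
  | right _ => fun _ => 0
  end.

Definition sinTheta d r (X Xt : 'M[R]_(d, r)) : 'M[R]_r :=
  diag_mx (\row_(i < r) Num.sqrt (1 - svals (X^T *m Xt) i ^+ 2)).

End Defs.

(* Main.v *)
(** With [U1], [U2] the leading and trailing left singular vectors of [A] and
    [Ut1] the leading ones of [A + dA], Pythagoras gives
    [|sinTheta U1 Ut1| = |X|] for [X = U2^T Ut1], and likewise [Y = V2^T Vt1] on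
    the right. Multiplying [(A + dA) Vt1 = Ut1 D] by [U2^T], and the transposed
    relation by [V2^T], yields the coupled Sylvester equations
      [X D = S2 Y + U2^T dA Vt1]   and   [Y D = S2^T X + V2^T dA^T Ut1].
    Weyl's inequality bounds [D] below by [s = sigma_r - |dA|], so that
    [s |X| <= b |Y| + f] and [s |Y| <= b |X| + g], whence
    [(s^2 - b^2) |X| <= s f + b g]. The first bound is the choice
    [b = sigma_(r+1)], [f = g = |dA|]; the second comes from splitting
    [Vt1 = V1 V1^T Vt1 + V2 Y] in the perturbation term, which gives
    [b = sigma_(r+1) + |a22|], [f = |a21|], [g = |a12|].
    A singular value decomposition of [U1^T Ut1] is obtained by maximising
    [|M v|] over the unit sphere and deflating with Householder reflections. *)
Require Import Defs.
From HB Require Import structures.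
From mathcomp Require Import all_boot all_order all_algebra.
From mathcomp Require Import boolp classical_sets reals.
From mathcomp Require Import topology normedtype derive ring lra.
Import numFieldNormedType.Exports.
Import Order.TTheory GRing.Theory Num.Theory.
Local Open Scope ring_scope.

(** * Inner product and Euclidean norm of column vectors *)

Section EuclideanNorm.
Set Implicit Arguments.
Unset Strict Implicit.
Context {R : realType}.

Definition dotv {q} (x y : 'cV[R]_q) : R := (x^T *m y) 0 0.

Lemma dotvE q (x y : 'cV[R]_q) : dotv x y = \sum_i x i 0 * y i 0.
Proof. by rewrite /dotv mxE; apply: eq_bigr => i _; rewrite mxE. Qed.

Lemma dotvC q (x y : 'cV[R]_q) : dotv x y = dotv y x.
Proof. by rewrite !dotvE; apply: eq_bigr => i _; rewrite mulrC. Qed.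

Lemma dotvDr q (x y z : 'cV[R]_q) : dotv x (y + z) = dotv x y + dotv x z.
Proof. by rewrite /dotv mulmxDr mxE. Qed.

Lemma dotvDl q (x y z : 'cV[R]_q) : dotv (y + z) x = dotv y x + dotv z x.
Proof. by rewrite dotvC dotvDr !(dotvC x). Qed.

Lemma dotvZr q a (x y : 'cV[R]_q) : dotv x (a *: y) = a * dotv x y.
Proof. by rewrite /dotv -scalemxAr mxE. Qed.

Lemma dotvZl q a (x y : 'cV[R]_q) : dotv (a *: x) y = a * dotv x y.
Proof. by rewrite dotvC dotvZr dotvC. Qed.

Lemma dotv_mull p q (M : 'M[R]_(p, q)) x y :
  dotv (M *m x) y = dotv x (M^T *m y).
Proof. by rewrite /dotv trmx_mul mulmxA. Qed.

Lemma dotv_ge0 q (x : 'cV[R]_q) : 0 <= dotv x x.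
Proof. by rewrite dotvE sumr_ge0 // => i _; rewrite -expr2 sqr_ge0. Qed.

Lemma dotv_eq0 q (x : 'cV[R]_q) : dotv x x = 0 -> x = 0.
Proof.
rewrite dotvE => /eqP; rewrite psumr_eq0 => [/allP x0|i _].
  apply/colP => i; rewrite mxE; apply/eqP.
  by have := x0 i; rewrite mem_index_enum mulf_eq0 orbb; apply.
by rewrite -expr2 sqr_ge0.
Qed.

Lemma vnorm2E q (x : 'cV[R]_q) : vnorm2 x = Num.sqrt (dotv x x).
Proof. by rewrite /vnorm2 dotvE; under eq_bigr do rewrite expr2. Qed.

Lemma vnorm2_ge0 q (x : 'cV[R]_q) : 0 <= vnorm2 x.
Proof. exact: sqrtr_ge0. Qed.

Lemma sqr_vnorm2 q (x : 'cV[R]_q) : vnorm2 x ^+ 2 = dotv x x.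
Proof. by rewrite vnorm2E sqr_sqrtr ?dotv_ge0. Qed.

Lemma vnorm2_eq0 q (x : 'cV[R]_q) : vnorm2 x = 0 -> x = 0.
Proof. by move=> x0; apply: dotv_eq0; rewrite -sqr_vnorm2 x0 expr0n. Qed.

Lemma vnorm2_0 q : vnorm2 (0 : 'cV[R]_q) = 0.
Proof. by rewrite vnorm2E /dotv mulmx0 mxE sqrtr0. Qed.

Lemma vnorm2_gt0 q (x : 'cV[R]_q) : x != 0 -> 0 < vnorm2 x.
Proof.
by move=> x0; rewrite lt_def vnorm2_ge0 andbT; apply: contra x0 => /eqP/vnorm2_eq0 ->.
Qed.

Lemma vnorm2Z q a (x : 'cV[R]_q) : vnorm2 (a *: x) = `|a| * vnorm2 x.
Proof.
by rewrite !vnorm2E dotvZl dotvZr mulrA -expr2 sqrtrM ?sqr_ge0 // sqrtr_sqr.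
Qed.

Lemma le_vnorm2 p q (x : 'cV[R]_p) (y : 'cV[R]_q) :
  (vnorm2 x <= vnorm2 y) = (dotv x x <= dotv y y).
Proof. by rewrite !vnorm2E ler_sqrt // dotv_ge0. Qed.

Lemma dotv_CauchySchwarz q (x y : 'cV[R]_q) :
  dotv x y ^+ 2 <= dotv x x * dotv y y.
Proof.
have [x0|x0] := eqVneq (dotv x x) 0.
  by rewrite x0 (dotv_eq0 x0) /dotv trmx0 mul0mx mxE expr0n mul0r.
have xgt0 : 0 < dotv x x by rewrite lt_def x0 dotv_ge0.
(* This vector is [dotv x x] times the component of [y] orthogonal to [x]; its squared norm factors
   as [a * (a * c - b ^+ 2)]. *)
have := dotv_ge0 (dotv x x *: y + - dotv x y *: x).
rewrite !(dotvDl, dotvDr, dotvZl, dotvZr) (dotvC y x).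
set a := dotv x x; set b := dotv x y; set c := dotv y y => h.
have : 0 <= a * (a * c - b ^+ 2) by move: h; congr (_ <= _); ring.
by rewrite pmulr_rge0 // subr_ge0.
Qed.

Lemma dotv_le q (x y : 'cV[R]_q) : dotv x y <= vnorm2 x * vnorm2 y.
Proof.
apply: le_trans (ler_norm _) _; rewrite -sqrtr_sqr !vnorm2E -sqrtrM ?dotv_ge0 //.
by rewrite ler_sqrt ?mulr_ge0 ?dotv_ge0 // dotv_CauchySchwarz.
Qed.

Lemma vnorm2D q (x y : 'cV[R]_q) : vnorm2 (x + y) <= vnorm2 x + vnorm2 y.
Proof.
rewrite -(@ler_pXn2r _ 2) ?nnegrE ?addr_ge0 ?vnorm2_ge0 // sqr_vnorm2.
rewrite !(dotvDl, dotvDr) sqrrD !sqr_vnorm2 (dotvC y x).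
by have := dotv_le x y; lra.
Qed.

Lemma vnorm2_isometry p q (Q : 'M[R]_(p, q)) x :
  Q^T *m Q = 1%:M -> vnorm2 (Q *m x) = vnorm2 x.
Proof. by move=> QQ; rewrite !vnorm2E dotv_mull mulmxA QQ mul1mx. Qed.

Lemma dotv_unit q (x : 'cV[R]_q) : vnorm2 x = 1 -> dotv x x = 1.
Proof. by move=> x1; rewrite -sqr_vnorm2 x1 expr1n. Qed.

End EuclideanNorm.

(** * Operator bounds and the spectral norm *)

Section OperatorBound.
Set Implicit Arguments.
Unset Strict Implicit.
Context {R : realType}.

(** The homogeneous form composes under sums and products without suprema and stays meaningful for
    [q = 0], where there are no unit vectors. *)
Definition opbound {p q} (M : 'M[R]_(p, q)) (c : R) : Prop :=
  forall x : 'cV[R]_q, vnorm2 (M *m x) <= c * vnorm2 x.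

Lemma opboundD p q (M N : 'M[R]_(p, q)) a b :
  opbound M a -> opbound N b -> opbound (M + N) (a + b).
Proof.
move=> Ma Nb x; rewrite mulmxDl mulrDl.
exact: le_trans (vnorm2D _ _) (lerD (Ma x) (Nb x)).
Qed.

Lemma opboundM p q s (M : 'M[R]_(p, q)) (N : 'M[R]_(q, s)) a b : 0 <= a ->
  opbound M a -> opbound N b -> opbound (M *m N) (a * b).
Proof.
move=> a0 Ma Nb x; rewrite -mulmxA -mulrA.
exact: le_trans (Ma _) (ler_wpM2l a0 (Nb x)).
Qed.

(** With [z = M^T *m x], the square of [|z|] is [dotv x (M *m z)], at most [|x| * (a * |z|)]; divide
    by [|z|]. *)
Lemma opbound_tr p q (M : 'M[R]_(p, q)) a : 0 <= a ->
  opbound M a -> opbound M^T a.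
Proof.
move=> a0 Ma x; have [z0|z0] := eqVneq (M^T *m x) 0.
  by rewrite z0 vnorm2_0 mulr_ge0 ?vnorm2_ge0.
rewrite -(ler_pM2r (vnorm2_gt0 z0)) -expr2 sqr_vnorm2 dotv_mull trmxK.
apply: le_trans (dotv_le _ _) _.
by rewrite -mulrA mulrCA ler_wpM2l ?vnorm2_ge0.
Qed.

Lemma opbound_isometry p q (Q : 'M[R]_(p, q)) :
  Q^T *m Q = 1%:M -> opbound Q 1.
Proof. by move=> QQ x; rewrite vnorm2_isometry // mul1r. Qed.

Lemma opbound_isometry_tr p q (Q : 'M[R]_(p, q)) :
  Q^T *m Q = 1%:M -> opbound Q^T 1.
Proof. by move=> QQ; apply: opbound_tr (opbound_isometry QQ). Qed.

(** The Frobenius norm works, by Cauchy-Schwarz on each row. This bounds the set in [specnorm], so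
    that its [sup] is an upper bound. *)
Lemma opbound_exists p q (M : 'M[R]_(p, q)) : exists c, opbound M c.
Proof.
exists (Num.sqrt (\sum_i dotv (row i M)^T (row i M)^T)) => x.
have F0 : 0 <= \sum_i dotv (row i M)^T (row i M)^T.
  by rewrite sumr_ge0 // => i _; exact: dotv_ge0.
rewrite !vnorm2E -sqrtrM // ler_sqrt ?mulr_ge0 ?dotv_ge0 //.
rewrite dotvE mulr_suml; apply: ler_sum => i _.
suff -> : (M *m x) i 0 = dotv (row i M)^T x by rewrite -expr2 dotv_CauchySchwarz.
by rewrite dotvE mxE; apply: eq_bigr => j _; rewrite !mxE.
Qed.

Lemma specnorm_ub p q (M : 'M[R]_(p, q)) (x : 'cV[R]_q) : vnorm2 x = 1 ->
  vnorm2 (M *m x) <= specnorm M.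
Proof.
move=> x1; apply: ub_le_sup; last by exists x.
by have [c Mc] := opbound_exists M; exists c => _ [y /= y1 <-]; rewrite -[c]mulr1 -y1.
Qed.

Lemma opbound_unit p q (M : 'M[R]_(p, q)) c :
  (forall x, vnorm2 x = 1 -> vnorm2 (M *m x) <= c) -> opbound M c.
Proof.
move=> Mc x; have [->|x0] := eqVneq x 0; first by rewrite mulmx0 !vnorm2_0 mulr0.
have xgt0 := vnorm2_gt0 x0.
rewrite -ler_pdivrMr // mulrC -[_^-1]ger0_norm ?invr_ge0 ?vnorm2_ge0 //.
rewrite -vnorm2Z scalemxAr Mc // vnorm2Z ger0_norm ?invr_ge0 ?vnorm2_ge0 //.
by rewrite mulVf // gt_eqF.
Qed.

Lemma opbound_specnorm p q (M : 'M[R]_(p, q)) : opbound M (specnorm M).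
Proof. by apply: opbound_unit => x; exact: specnorm_ub. Qed.

Lemma specnorm_ge0 p q (M : 'M[R]_(p, q)) : 0 <= specnorm M.
Proof.
rewrite /specnorm; set S := (X in sup X).
(* Without columns there is no unit vector, and [sup] of the empty set is 0. *)
have [[y Sy]|/nonemptyPn ->] := pselect (S !=set0)%classic; last by rewrite sup0.
by case: (Sy) => x /= x1 _; exact: le_trans (vnorm2_ge0 _) (specnorm_ub M x1).
Qed.

Lemma specnorm_le p q (M : 'M[R]_(p, q)) c : 0 <= c -> opbound M c -> specnorm M <= c.
Proof.
move=> c0 Mc; rewrite /specnorm; set S := (X in sup X).
have [S0|/nonemptyPn ->] := pselect (S !=set0)%classic; last by rewrite sup0.
by apply: ge_sup => // _ [x /= x1 <-]; rewrite -[c]mulr1 -x1.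
Qed.

Lemma opbound_diag p q (M : 'M[R]_(p, q)) c : 0 <= c ->
  (forall (i : 'I_p) (j : 'I_q), (i : nat) != j -> M i j = 0) ->
  (forall (i : 'I_p) (j : 'I_q), (i : nat) = j -> `|M i j| <= c) -> opbound M c.
Proof.
move=> c0 M0 Mc x; rewrite -[c]ger0_norm // -vnorm2Z le_vnorm2.
rewrite !dotvE.
(* Each row has at most one nonzero entry, and none if [q <= i], so the square of the sum is the sum
   of the squares. *)
have row_sum i : (M *m x) i 0 * (M *m x) i 0 = \sum_j M i j ^+ 2 * x j 0 ^+ 2.
  rewrite mxE; have [iq|qi] := ltnP i q.
    have ji j : j != Ordinal iq -> M i j = 0.
      by move=> ji; apply: M0; rewrite eq_sym -val_eqE in ji *.
    rewrite (bigD1 (Ordinal iq)) //= big1 => [|j /ji ->]; last by rewrite mul0r.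
    rewrite (bigD1 (Ordinal iq)) //= big1 => [|j /ji ->]; last by rewrite expr0n mul0r.
    by rewrite !addr0; ring.
  by rewrite !big1 ?mulr0 // => j _; rewrite M0 ?expr0n ?mul0r // gtn_eqF // (leq_trans _ qi).
under eq_bigr do rewrite row_sum.
rewrite exchange_big; apply: ler_sum => j _ /=; rewrite !mxE -mulr_suml.
have -> : c * x j 0 * (c * x j 0) = c ^+ 2 * x j 0 ^+ 2 by ring.
apply: ler_wpM2r; first exact: sqr_ge0.
have [jp|pj] := ltnP j p.
  rewrite (bigD1 (Ordinal jp)) //= big1 => [|i ij]; last by rewrite M0 ?expr0n.
  rewrite addr0 -[leLHS]real_normK ?num_real // ler_pXn2r ?nnegrE //.
  exact: Mc.
by rewrite big1 ?sqr_ge0 // => i _; rewrite M0 ?expr0n // ltn_eqF // (leq_trans _ pj).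
Qed.

End OperatorBound.

(** * Existence of singular value decompositions of square matrices *)

Section SingularValueDecomposition.
Set Implicit Arguments.
Unset Strict Implicit.
Context {R : realType}.

Lemma continuous_dotv_mul p q (M : 'M[R]_(p, q)) :
  continuous (fun x : 'rV[R]_q => dotv (M *m x^T) (M *m x^T)).
Proof.
rewrite (_ : (fun _ => _) = fun y : 'rV[R]_q =>
  \sum_i (\sum_j M i j * y 0 j) * (\sum_j M i j * y 0 j)); last first.
  apply/funext => y; rewrite dotvE; apply: eq_bigr => i _.
  by rewrite !mxE; under eq_bigr do rewrite mxE.
have inner i : continuous (fun y : 'rV[R]_q => \sum_j M i j * y 0 j).
  apply: (continuous_big add_continuous) => j _ y.
  by apply: continuousM; [exact: cst_continuous | exact: coord_continuous].
apply: (continuous_big add_continuous) => i _ y.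
by apply: continuousM; exact: inner.
Qed.

(** The unit sphere is closed in a cube of side [[-1, 1]], hence compact, and the continuous
    function [|M x| ^+ 2] attains its maximum on it. *)
Lemma opbound_attained n (M : 'M[R]_n.+1) :
  exists2 v : 'cV[R]_n.+1, vnorm2 v = 1 & opbound M (vnorm2 (M *m v)).
Proof.
pose f (N : 'M[R]_n.+1) (x : 'rV[R]_n.+1) := dotv (N *m x^T) (N *m x^T).
pose S : set 'rV[R]_n.+1 := (f 1%:M @^-1` [set 1])%classic.
have S0 : (S !=set0)%classic.
  exists (delta_mx 0 0); rewrite /S /f /= mul1mx dotvE (bigD1 0) //= big1.
    by rewrite !mxE !eqxx mulr1 addr0.
  by move=> i i0; rewrite !mxE (negPf i0) mul0r.
have cS : compact S.
  apply: (subclosed_compact _ (A := S)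
    (@rV_compact _ _ (fun=> `[(-1 : R), 1]%classic) (fun=> @segment_compact _ _ _))).
    apply: preimage_closed; last exact: closed_eq.
    by move=> x _; exact: continuous_dotv_mul.
  move=> x; rewrite /S /f /= mul1mx dotvE => x1 j.
  rewrite in_itv /= -ler_norml -(@ler_pXn2r _ 2) ?nnegrE // expr1n real_normK ?num_real //.
  rewrite -x1 (bigD1 j) //= mxE expr2 lerDl sumr_ge0 // => i _.
  by rewrite -expr2 sqr_ge0.
have [v /set_mem vS vmax] := compact_EVT_max S0 cS
  (continuous_subspaceT (@continuous_dotv_mul _ _ M)).
have v1 : vnorm2 v^T = 1.
  by rewrite vnorm2E; move: vS; rewrite /S /f /= mul1mx => ->; rewrite sqrtr1.
exists v^T => //; apply: opbound_unit => x x1.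
rewrite le_vnorm2; have := vmax x^T; rewrite /= trmxK; apply.
by apply/mem_set; rewrite /S /f /= trmxK mul1mx dotv_unit.
Qed.

Lemma dotv_col_mx p q (a c : 'cV[R]_p) (b d : 'cV[R]_q) :
  dotv (col_mx a b) (col_mx c d) = dotv a c + dotv b d.
Proof. by rewrite /dotv tr_col_mx mul_row_col mxE. Qed.

(** [H] reflects across the hyperplane orthogonal to [w = v - e]. Equal norms give
    [dotv w e = - dotv w w / 2], so that [e] goes to [e + w = v]. *)
Lemma householder n (e v : 'cV[R]_n) : vnorm2 e = 1 -> vnorm2 v = 1 ->
  exists2 H : 'M[R]_n, H^T *m H = 1%:M & H *m e = v.
Proof.
move=> /dotv_unit e1 /dotv_unit v1; have [ev|nev] := eqVneq v e.
  by exists 1%:M; rewrite ?trmx1 mul1mx ?ev.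
pose w := v - e; have w0 : dotv w w != 0.
  by apply: contra nev => /eqP/dotv_eq0/eqP; rewrite subr_eq0.
have ww : w^T *m w = (dotv w w)%:M by exact: mx11_scalar.
have we : w^T *m e = (- dotv w w / 2)%:M.
  rewrite [LHS]mx11_scalar -/(dotv w e); congr (_%:M).
  rewrite /w -[- e]scaleN1r !(dotvDl, dotvDr, dotvZl, dotvZr) e1 v1 (dotvC e v).
  by field.
pose H := 1%:M - (2 / dotv w w) *: (w *m w^T).
have HT : H^T = H.
  by rewrite /H linearB /= linearZ /= trmx_mul trmxK trmx1.
exists H.
  rewrite HT /H mulmxBl mul1mx mulmxBr mulmx1 -scalemxAl -scalemxAr.
  rewrite mulmxA -(mulmxA w w^T w) ww mul_mx_scalar -scalemxAl.
  rewrite !scalerA opprB -scalerBl -scaleNr -addrA -scalerDl.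
  set a := (X in X *: _); suff -> : a = 0 by rewrite scale0r addr0.
  by rewrite /a; field.
rewrite /H mulmxBl mul1mx -scalemxAl -mulmxA we mul_mx_scalar.
rewrite scalerA; set a := (X in X *: w).
by have -> : a = -1; [rewrite /a; field | rewrite scaleN1r opprK addrC subrK].
Qed.

Lemma svd_exists n (M : 'M[R]_n) : exists P Q : 'M[R]_n, exists d : nat -> R,
  [/\ P^T *m P = 1%:M, Q^T *m Q = 1%:M,
      M = P *m diag_mx (\row_i d i) *m Q^T,
      (forall k, 0 <= d k) /\ (forall k, d k.+1 <= d k) &
      (* Carries the ordering of the singular values through the induction. *)
      forall c, 0 <= c -> opbound M c -> forall k, d k <= c].
Proof.
elim: n M => [M|n IH].
  exists 1%:M, 1%:M, (fun=> 0).
  by split=> //; rewrite ?trmx1 ?mulmx1 //; apply/matrixP => - [].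
(* For [M = 0] the maximum [s] vanishes and [M *m v] cannot be normalised. *)
rewrite -add1n => M; have [->|M0] := eqVneq M 0.
  exists 1%:M, 1%:M, (fun=> 0).
  split=> //; rewrite ?trmx1 ?mulmx1 // ?mul1mx.
  by apply/matrixP => i j; rewrite !mxE mul0rn.
have [v v1 Mv] : exists2 v : 'cV_(1 + n), vnorm2 v = 1 & opbound M (vnorm2 (M *m v)) :=
  opbound_attained M.
set s := vnorm2 (M *m v) in Mv.
have s0 : s != 0.
  apply: contra M0 => /eqP s0; apply/eqP/matrixP => i j.
  have := Mv (delta_mx j 0); rewrite s0 mul0r -colE => cj.
  have/vnorm2_eq0/colP/(_ i) : vnorm2 (col j M) = 0.
    by apply: le_anti; rewrite cj vnorm2_ge0.
  by rewrite !mxE.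
have sgt0 : 0 < s by rewrite lt_def s0 vnorm2_ge0.
pose u := s^-1 *: (M *m v).
have u1 : vnorm2 u = 1.
  by rewrite vnorm2Z ger0_norm ?invr_ge0 ?(ltW sgt0) // mulVf.
(* Maximality gives [|M^T u| <= s], while [dotv (M^T *m u) v = s]; hence the squared norm of
   [M^T u - s v] is at most [s^2 - 2 s^2 + s^2 = 0]. *)
have Mu : M^T *m u = s *: v.
  have Muv : dotv (M^T *m u) v = s.
    by rewrite dotv_mull trmxK /u dotvZl -sqr_vnorm2 -/s expr2 mulrA mulVf // mul1r.
  apply/eqP; rewrite -subr_eq0; apply/eqP/dotv_eq0/le_anti.
  rewrite dotv_ge0 andbT -[- (s *: v)]scaleNr.
  rewrite !(dotvDl, dotvDr, dotvZl, dotvZr) (dotvC v) Muv (dotv_unit v1) -sqr_vnorm2.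
  have := opbound_tr (ltW sgt0) Mv u; rewrite u1 mulr1 => h.
  have : vnorm2 (M^T *m u) ^+ 2 <= s ^+ 2 by rewrite ler_pXn2r ?nnegrE ?vnorm2_ge0 ?(ltW sgt0).
  by nra.
pose e : 'cV[R]_(1 + n) := delta_mx 0 0.
have e1 : vnorm2 e = 1.
  rewrite vnorm2E dotvE (bigD1 0) //= big1 => [|i i0].
    by rewrite !mxE !eqxx mulr1 addr0 sqrtr1.
  by rewrite !mxE (negPf i0) mul0r.
have [H HH He] := householder e1 u1.
have [K KK Ke] := householder e1 v1.
have [N NE] : exists N : 'M[R]_(1 + n), N = H^T *m M *m K by exists (H^T *m M *m K).
have HHT := mulmx1C HH; have KKT := mulmx1C KK.
have Ne : N *m e = s *: e.
  rewrite NE -!mulmxA Ke.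
  have -> : M *m v = s *: u by rewrite /u scalerA mulfV // scale1r.
  by rewrite -He -scalemxAr mulmxA HH mul1mx.
have NTe : N^T *m e = s *: e.
  rewrite NE !trmx_mul trmxK -!mulmxA He Mu -Ke -scalemxAr.
  by rewrite mulmxA KK mul1mx.
have Ns : opbound N s.
  rewrite NE -[s]mulr1 -[s]mul1r.
  apply: opboundM; rewrite ?mul1r ?(ltW sgt0) //; last exact: opbound_isometry.
  by rewrite -[s]mul1r; apply: opboundM => //; exact: opbound_isometry_tr.
pose B := drsubmx N.
(* [Ne] determines the first column of [N] and [NTe] its first row; both vanish off the corner. *)
have Nblock : N = block_mx s%:M 0 0 B.
  have N0 i : N i 0 = s *+ (i == 0).
    have := congr1 (fun X : 'cV_(1 + n) => X i 0) Ne.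
    by rewrite -colE !mxE eqxx andbT mulr_natr.
  have N0' i : N 0 i = s *+ (i == 0).
    have := congr1 (fun X : 'cV_(1 + n) => X i 0) NTe.
    by rewrite -colE !mxE eqxx andbT mulr_natr.
  rewrite -[LHS]submxK -/B; congr block_mx; apply/matrixP => i j; rewrite !mxE.
  - by rewrite !ord1 lshift0 N0.
  - by rewrite ord1 lshift0 N0'.
  - by rewrite ord1 lshift0 N0.
have Bs : opbound B s.
  move=> x; have := Ns (col_mx 0 x); rewrite Nblock mul_block_col.
  by rewrite !mulmx0 mul0mx !add0r !vnorm2E !dotv_col_mx {1 3}/dotv mulmx0 mxE !add0r.
have [P [Q [d [PP QQ BE [d0 dd] dmax]]]] := IH B.
exists (H *m block_mx 1%:M 0 0 P), (K *m block_mx 1%:M 0 0 Q).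
exists (fun k => if k is k'.+1 then d k' else s); split.
- rewrite trmx_mul mulmxA -(mulmxA _ H^T) HH mulmx1.
  rewrite tr_block_mx mulmx_block !trmx0 trmx1 !mulmx0 !mul0mx !addr0 add0r mulmx1 PP.
  by rewrite -scalar_mx_block.
- rewrite trmx_mul mulmxA -(mulmxA _ K^T) KK mulmx1.
  rewrite tr_block_mx mulmx_block !trmx0 trmx1 !mulmx0 !mul0mx !addr0 add0r mulmx1 QQ.
  by rewrite -scalar_mx_block.
- have -> : M = H *m N *m K^T by rewrite NE !mulmxA HHT mul1mx -mulmxA KKT mulmx1.
  rewrite trmx_mul !mulmxA; congr (_ *m _); rewrite -!mulmxA; congr (_ *m _).
  have -> : diag_mx (\row_(i < 1 + n) (if i : nat is k'.+1 then d k' else s)) =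
      block_mx s%:M 0 0 (diag_mx (\row_i d i)) .
    rewrite -[LHS]submxK; congr block_mx; apply/matrixP => i j; rewrite !mxE.
    - by rewrite !ord1.
    - by rewrite eq_lrshift.
    - by rewrite eq_rlshift.
    - by rewrite eq_rshift.
  rewrite tr_block_mx !mulmx_block !trmx0 trmx1 !mulmx0 !mul0mx !mul1mx !addr0 !add0r mulmx1.
  by rewrite Nblock BE !mulmxA mulmx0.
- split=> - [|k] //=; first exact: vnorm2_ge0.
  (* The singular values of [B] are at most [s], so [s] may be put in front of them. *)
  by apply: dmax (ltW sgt0) Bs _.
- move=> c c0 Mc k; have sc : s <= c by have := Mc v; rewrite v1 mulr1.
  by case: k => // k; apply: le_trans sc; apply: dmax (ltW sgt0) Bs _.
Qed.

Lemma mxe_ord p q (M : 'M[R]_(p, q)) (i : 'I_p) (j : 'I_q) : mxe M i j = M i j.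
Proof. by rewrite /mxe !valK. Qed.

(** Existence rules out the default branch of [svals], so the cosines in [sinTheta] are genuine
    singular values. *)
Lemma is_svals_svals n (M : 'M[R]_n) : is_svals M (svals M).
Proof.
rewrite /svals; case: pselect => [H|[]]; first exact: proj2_sig (cid H).
have [P [Q [d [PP QQ ME [d0 dd] _]]]] := svd_exists M.
have rd k : (k < n)%N -> rdiag (diag_mx (\row_(i < n) d i)) k = d k.
  by move=> kn; rewrite /rdiag (mxe_ord _ (Ordinal kn) (Ordinal kn)) !mxE eqxx.
exists d, P, (diag_mx (\row_i d i)), Q; split; last by rewrite minnn.
split=> //; first by move=> i j ij; rewrite !mxE -val_eqE (negPf ij).
rewrite minnn; split=> [k kn|k l kl ln]; first by rewrite rd.
rewrite !rd ?(leq_ltn_trans kl) //.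
by apply: (homo_leq (r := fun a b => b <= a)) kl => // y x z; exact: (ge_trans (y := y)).
Qed.

(** * Norm of the sines of the canonical angles *)

Lemma specnorm_sinTheta_le1 p r (X Y : 'M[R]_(p, r)) : specnorm (sinTheta X Y) <= 1.
Proof.
apply: specnorm_le => //; apply: opbound_diag => // i j; rewrite !mxE -val_eqE.
  by move=> /negPf ->.
move=> /val_inj ->; rewrite eqxx mulr1n ger0_norm ?sqrtr_ge0 //.
by rewrite -[leRHS]sqrtr1 ler_sqrt // gerBl sqr_ge0.
Qed.

(* Applied to a right singular vector [x] of [X1^T *m Y] with singular value
   [z], Pythagoras gives [1 - z ^+ 2 = |X2^T *m Y *m x| ^+ 2]. *)
Lemma specnorm_sinTheta_le p k r (X1 Y : 'M[R]_(p, r)) (X2 : 'M[R]_(p, k)) c :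
  X1 *m X1^T + X2 *m X2^T = 1%:M -> Y^T *m Y = 1%:M ->
  0 <= c -> opbound (X2^T *m Y) c -> specnorm (sinTheta X1 Y) <= c.
Proof.
move=> XX YY c0 Xc.
have [P [D [Q [[PP QQ ME D0 _] sD]]]] := is_svals_svals (X1^T *m Y).
apply: specnorm_le => //; apply: opbound_diag => // i j; rewrite !mxE -val_eqE.
  by move=> /negPf ->.
move=> /val_inj <-; rewrite eqxx mulr1n ger0_norm ?sqrtr_ge0 //.
rewrite -sD ?minnn // /rdiag mxe_ord.
pose e : 'cV[R]_r := delta_mx i 0; pose x := Q *m e.
have ee : dotv e e = 1.
  rewrite dotvE (bigD1 i) //= big1 => [|l li]; first by rewrite !mxE !eqxx mulr1 addr0.
  by rewrite !mxE (negPf li) mul0r.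
have x1 : vnorm2 x = 1 by rewrite vnorm2_isometry // vnorm2E ee sqrtr1.
have Mx : dotv (X1^T *m Y *m x) (X1^T *m Y *m x) = D i i ^+ 2.
  rewrite -sqr_vnorm2 ME /x -!mulmxA (mulmxA Q^T) QQ mul1mx vnorm2_isometry //.
  rewrite sqr_vnorm2 dotvE -colE (bigD1 i) //= big1 => [|l li].
    by rewrite addr0 !mxE expr2.
  by rewrite !mxE D0 ?mul0r.
have pythagoras : dotv (X1^T *m Y *m x) (X1^T *m Y *m x)
    + dotv (X2^T *m Y *m x) (X2^T *m Y *m x) = 1.
  rewrite -!mulmxA ![dotv (_ *m (Y *m x)) _]dotv_mull !trmxK -dotvDr.
  rewrite !(mulmxA _ _ (Y *m x)) -mulmxDl XX mul1mx.
  by rewrite -sqr_vnorm2 vnorm2_isometry // x1 expr1n.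
have -> : 1 - D i i ^+ 2 = vnorm2 (X2^T *m Y *m x) ^+ 2.
  by rewrite sqr_vnorm2 -Mx -pythagoras addrC addKr.
by rewrite sqrtr_sqr ger0_norm ?vnorm2_ge0 // -[c]mulr1 -x1.
Qed.

End SingularValueDecomposition.

(** * Leading and trailing singular blocks, and Weyl's inequality *)

Section SingularSubspaces.
Set Implicit Arguments.
Unset Strict Implicit.
Context {R : realType}.

(** Right multiplication by this selection matrix extracts the columns [f j]; it makes [lcols] and
    [rcols] products and avoids casts between [c] and [r + (c - r)]. *)
Definition colsel c k (f : nat -> nat) : 'M[R]_(c, k) :=
  \matrix_(i, j) ((i : nat) == f j)%:R.

Lemma mul_colsel p c k (M : 'M[R]_(p, c)) f :
  M *m colsel c k f = \matrix_(i, j) mxe M i (f j).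
Proof.
apply/matrixP => i j; rewrite !mxE /mxe valK.
case: insubP => [l _ lE|cl].
  rewrite (bigD1 l) //= big1 => [|h hl]; rewrite mxE -lE ?eqxx ?mulr1 ?addr0 //.
  by rewrite val_eqE (negPf hl) mulr0.
(* An index beyond the last column selects nothing, in agreement with the default 0 of [mxe]. *)
by rewrite big1 // => h _; rewrite mxE ltn_eqF ?mulr0 // (leq_trans (ltn_ord h)) // leqNgt.
Qed.

Lemma mxe_tr p q (M : 'M[R]_(p, q)) i j : mxe M^T i j = mxe M j i.
Proof. by rewrite /mxe; case: insub => [?|]; case: insub => [?|] //; rewrite mxE. Qed.

Lemma colsel_tr_mul p c k l (M : 'M[R]_(p, c)) f g :
  (colsel p l g)^T *m M *m colsel c k f = \matrix_(i, j) mxe M (g i) (f j).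
Proof.
rewrite -mulmxA mul_colsel -[LHS]trmxK trmx_mul trmxK mul_colsel.
apply/matrixP => i j; rewrite !mxE /mxe valK.
by case: insub => [?|] //; rewrite !mxE /mxe valK.
Qed.

Lemma lcols_colsel d c r (X : 'M[R]_(d, c)) : lcols r X = X *m colsel c r id.
Proof. by rewrite mul_colsel. Qed.

Lemma rcols_colsel d c r (X : 'M[R]_(d, c)) :
  rcols r X = X *m colsel c (c - r) (addn r).
Proof. by rewrite mul_colsel. Qed.

Lemma colsel_unit c k f : injective f -> (forall j, (j < k)%N -> (f j < c)%N) ->
  (colsel c k f)^T *m colsel c k f = 1%:M.
Proof.
move=> injf fc; rewrite -[X in X *m _]mulmx1 colsel_tr_mul; apply/matrixP => i j.
rewrite !mxE (mxe_ord _ (Ordinal (fc _ (ltn_ord i))) (Ordinal (fc _ (ltn_ord j)))).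
by rewrite mxE -val_eqE /= (inj_eq injf).
Qed.

Lemma mxe_diag p q (D : 'M[R]_(p, q)) (i j : nat) :
  (forall (i : 'I_p) (j : 'I_q), (i : nat) != j -> D i j = 0) ->
  i != j -> mxe D i j = 0.
Proof.
move=> D0; rewrite /mxe; case: insubP => [i' _ <-|//]; case: insubP => [j' _ <-|//].
exact: D0.
Qed.

Lemma colsel_orth c r l : (colsel c r id)^T *m colsel c l (addn r) = 0.
Proof.
rewrite -[X in X *m _]mulmx1 colsel_tr_mul; apply/matrixP => i j; rewrite !mxE.
apply: mxe_diag => [i' j' ij|]; first by rewrite mxE -val_eqE (negPf ij).
by rewrite ltn_eqF // (leq_trans (ltn_ord i)) // leq_addr.
Qed.

Lemma colsel_cover c r : (r <= c)%N ->
  colsel c r id *m (colsel c r id)^T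
    + colsel c (c - r) (addn r) *m (colsel c (c - r) (addn r))^T = 1%:M.
Proof.
move=> rc; apply/matrixP => i j; rewrite !mxE.
pose F k : R := ((i : nat) == k)%:R * ((j : nat) == k)%:R.
rewrite (eq_bigr (fun k : 'I_r => F k)) => [|k _]; last by rewrite !mxE.
rewrite [X in _ + X](eq_bigr (fun k : 'I_(c - r) => F (k + r)%N)) => [|k _]; last first.
  by rewrite !mxE addnC.
(* Shifted by [r], the second range continues the first; the sums merge into one over [c], where
   only [k = i] survives. *)
rewrite -(big_mkord xpredT F) -(big_mkord xpredT (fun k => F (k + r)%N)).
rewrite -[X in _ + X](big_addn 0 c r xpredT F) add0n -big_cat_nat //= big_mkord.
rewrite (bigD1 i) //= big1 /F => [|k ki]; first by rewrite eqxx mul1r addr0 val_eqE eq_sym.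
by rewrite val_eqE eq_sym (negPf ki) mul0r.
Qed.

Lemma cols_split c r (P : 'M[R]_c) : P^T *m P = 1%:M -> (r <= c)%N ->
  [/\ (lcols r P)^T *m lcols r P = 1%:M, (rcols r P)^T *m rcols r P = 1%:M,
      (lcols r P)^T *m rcols r P = 0 &
      lcols r P *m (lcols r P)^T + rcols r P *m (rcols r P)^T = 1%:M].
Proof.
move=> PP rc; rewrite !lcols_colsel !rcols_colsel !trmx_mul.
have PPc k l (X : 'M[R]_(k, c)) (Y : 'M[R]_(c, l)) :
  X *m P^T *m (P *m Y) = X *m Y by rewrite mulmxA -(mulmxA X) PP mulmx1.
rewrite !PPc colsel_orth; split=> //.
- by apply: colsel_unit => // j jr; exact: leq_trans rc.
- by apply: colsel_unit => [|j jr]; [exact: addnI | rewrite -ltn_subRL].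
- rewrite -!mulmxA -mulmxDr 2!mulmxA -mulmxDl colsel_cover // mul1mx.
  exact: mulmx1C.
Qed.

Definition diag_block p q (D : 'M[R]_(p, q)) r k l : 'M[R]_(k, l) :=
  \matrix_(i, j) mxe D (r + i) (r + j).

(** Inserting [colsel_cover] on both sides of [D] gives four blocks; the two mixed ones vanish
    because [D] is diagonal. *)
Lemma svd_split p q (M : 'M[R]_(p, q)) P D Q r : is_svd M P D Q ->
  (r <= p)%N -> (r <= q)%N ->
  M = lcols r P *m diag_block D 0 r r *m (lcols r Q)^T
      + rcols r P *m diag_block D r (p - r) (q - r) *m (rcols r Q)^T.
Proof.
move=> [PP QQ -> D0 _] rp rq; rewrite !lcols_colsel !rcols_colsel !trmx_mul.
rewrite !mulmxA -mulmxDl; congr (_ *m _); rewrite -!mulmxA -mulmxDr; congr (_ *m _).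
set E1 := colsel p r id; set E2 := colsel p _ _.
set F1 := colsel q r id; set F2 := colsel q _ _.
have -> : diag_block D 0 r r = E1^T *m D *m F1 by rewrite colsel_tr_mul.
have -> : diag_block D r (p - r) (q - r) = E2^T *m D *m F2 by rewrite colsel_tr_mul.
have E1F2 : E1^T *m D *m F2 = 0.
  rewrite colsel_tr_mul; apply/matrixP => i j; rewrite !mxE mxe_diag //.
  by rewrite ltn_eqF // (leq_trans (ltn_ord i)) // leq_addr.
have E2F1 : E2^T *m D *m F1 = 0.
  rewrite colsel_tr_mul; apply/matrixP => i j; rewrite !mxE mxe_diag //.
  by rewrite gtn_eqF // (leq_trans (ltn_ord j)) // leq_addr.
rewrite -[LHS]mul1mx -(colsel_cover rp) -[LHS]mulmx1 -(colsel_cover rq) -/E1 -/E2 -/F1 -/F2.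
have regroup k l (E : 'M[R]_(p, k)) (F : 'M[R]_(q, l)) :
  E *m E^T *m D *m (F *m F^T) = E *m (E^T *m D *m F) *m F^T by rewrite !mulmxA.
rewrite !(mulmxDl, mulmxDr) !regroup E1F2 E2F1 !mulmx0 !mul0mx addr0 add0r.
by rewrite !mulmxA.
Qed.

Section SVD.
Context {p q : nat} {M : 'M[R]_(p, q)} {P : 'M[R]_p} {D : 'M[R]_(p, q)} {Q : 'M[R]_q}.
Hypothesis svdM : is_svd M P D Q.

Lemma svd_rdiag_ge0 k : (k < minn p q)%N -> 0 <= rdiag D k.
Proof. by case: svdM => _ _ _ _ [d0 _]; exact: d0. Qed.

Lemma diag_block_off r k l (i : 'I_k) (j : 'I_l) : (i : nat) != j ->
  diag_block D r k l i j = 0.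
Proof.
by move=> ij; rewrite mxE; case: svdM => _ _ _ D0 _; rewrite mxe_diag // eqn_add2l.
Qed.

(** Indices start at 0, so [rdiag D r] is the singular value of rank [r + 1], the largest entry of
    the trailing block. *)
Lemma opbound_trailing r : (r < minn p q)%N ->
  opbound (diag_block D r (p - r) (q - r)) (rdiag D r).
Proof.
move=> rpq; apply: opbound_diag => [||i j ij]; [exact: svd_rdiag_ge0|exact: diag_block_off|].
have ipq : (r + i < minn p q)%N.
  by rewrite leq_min -!ltn_subRL ltn_ord ij ltn_ord.
rewrite mxE -ij -/(rdiag D (r + i)) ger0_norm ?svd_rdiag_ge0 //.
by case: svdM => _ _ _ _ [_ dd]; apply: dd => //; rewrite leq_addr.
Qed.

Lemma diag_blockE k : diag_block D 0 k k = diag_mx (\row_i rdiag D i).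
Proof.
apply/matrixP => i j; have [->|ij] := eqVneq i j; first by rewrite !mxE eqxx.
by rewrite diag_block_off // !mxE (negPf ij).
Qed.

(** The smallest of the first [k.+1] diagonal entries is [rdiag D k], so all their reciprocals are
    at most [s^-1]. *)
Lemma leading_inverse k s : (k < minn p q)%N -> 0 < s -> s <= rdiag D k ->
  exists2 Di : 'M[R]_k.+1, diag_block D 0 k.+1 k.+1 *m Di = 1%:M & opbound Di s^-1.
Proof.
move=> kpq s0 sk.
have sd (i : 'I_k.+1) : s <= rdiag D i.
  by apply: le_trans sk _; case: svdM => _ _ _ _ [_ dd]; apply: dd; rewrite // -ltnS.
exists (diag_mx (\row_(i < k.+1) (rdiag D i)^-1)).
  rewrite diag_blockE mulmx_diag; apply/matrixP => i j; rewrite !mxE.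
  by rewrite mulfV // gt_eqF // (lt_le_trans s0).
apply: opbound_diag => [|i j ij|i j /val_inj <-]; first by rewrite invr_ge0 ltW.
  by rewrite !mxE -val_eqE (negPf ij).
have di0 : 0 < rdiag D i by exact: lt_le_trans (sd i).
by rewrite !mxE eqxx ger0_norm ?invr_ge0 ?(ltW di0) // lef_pV2.
Qed.

Lemma mul_lcols_svd r : (r <= p)%N -> (r <= q)%N ->
  M *m lcols r Q = lcols r P *m diag_block D 0 r r.
Proof.
move=> rp rq; have [_ QQ _ _ _] := svdM; have [Q11 _ Q12 _] := cols_split QQ rq.
rewrite [in LHS](svd_split svdM rp rq) mulmxDl -!mulmxA Q11 mulmx1.
by rewrite -[(rcols r Q)^T *m _]trmxK trmx_mul trmxK Q12 trmx0 !mulmx0 addr0.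
Qed.

Lemma tr_rcols_mul_svd r : (r <= p)%N -> (r <= q)%N ->
  (rcols r P)^T *m M = diag_block D r (p - r) (q - r) *m (rcols r Q)^T.
Proof.
move=> rp rq; have [PP _ _ _ _] := svdM; have [_ P22 P12 _] := cols_split PP rp.
rewrite [in LHS](svd_split svdM rp rq) mulmxDr !mulmxA P22 mul1mx.
by rewrite -[(rcols r P)^T *m lcols r P]trmxK trmx_mul trmxK P12 trmx0 !mul0mx add0r.
Qed.

End SVD.

(** Transposition exchanges left and right singular vectors, so estimates for the former transfer to
    the latter. *)
Lemma is_svd_tr p q (M : 'M[R]_(p, q)) P D Q : is_svd M P D Q -> is_svd M^T Q D^T P.
Proof.
move=> [PP QQ -> D0 dd]; split=> //; first by rewrite !trmx_mul trmxK mulmxA.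
  by move=> i j ij; rewrite mxE D0 // eq_sym.
have rdT k : rdiag D^T k = rdiag D k by rewrite /rdiag mxe_tr.
by rewrite minnC; case: dd => d0 dd; split=> [k|k l]; rewrite !rdT; [exact: d0|exact: dd].
Qed.

Lemma kernel_vector p q (N : 'M[R]_(p, q)) : (p < q)%N ->
  exists2 c : 'cV[R]_q, c != 0 & N *m c = 0.
Proof.
move=> pq; have : kermx N^T != 0.
  by rewrite kermx_eq0 /row_free neq_ltn (leq_ltn_trans (rank_leq_col _) pq).
case/rowV0Pn => v /sub_kermxP vN v0; exists v^T.
  by apply: contra v0 => /eqP v0; rewrite -[v]trmxK v0 trmx0.
by rewrite -[LHS]trmxK trmx_mul trmxK vN trmx0.
Qed.

(** One side of Weyl's inequality, by a dimension count: some nonzero [x] is stretched by [A] at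
    least by [rdiag D k] and by [A + dA] at most by [rdiag Dt k]. *)
Lemma singular_value_perturbation p q (A dA : 'M[R]_(p, q)) P D Q Pt Dt Qt k :
  is_svd A P D Q -> is_svd (A + dA) Pt Dt Qt -> (k < minn p q)%N ->
  rdiag D k <= rdiag Dt k + specnorm dA.
Proof.
move=> svdA svdAt kpq.
have [kp kq] : (k.+1 <= p)%N /\ (k.+1 <= q)%N by apply/andP; rewrite -leq_min.
have dt0 := svd_rdiag_ge0 svdAt kpq.
(* A vanishing singular value is trivial; a positive one makes the leading block of [D]
   invertible. *)
have [dk0|dk0] := leP (rdiag D k) 0.
  by apply: le_trans dk0 _; rewrite addr_ge0 ?specnorm_ge0.
have [Di DDi Dib] := leading_inverse svdA kpq dk0 (lexx _).
have [PP QQ _ _ _] := svdA; have [PtPt QtQt _ _ _] := svdAt.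
have [P11 _ _ _] := cols_split PP kp; have [Q11 _ _ _] := cols_split QQ kq.
have [_ Pt22 _ _] := cols_split PtPt (ltnW kp).
have [_ Qt22 _ _] := cols_split QtQt (ltnW kq).
(* [x = Q1 *m c] lies in the leading right subspace of [A] and is orthogonal to
   the first [k] right singular vectors of [A + dA]. *)
have [c c0 Qc] := kernel_vector ((lcols k Qt)^T *m lcols k.+1 Q) (ltnSn k).
pose x := lcols k.+1 Q *m c.
have xc : vnorm2 x = vnorm2 c by rewrite vnorm2_isometry.
have lower : rdiag D k * vnorm2 c <= vnorm2 (A *m x).
  rewrite mulmxA (mul_lcols_svd svdA) // -mulmxA vnorm2_isometry //.
  set y := _ *m c; have -> : c = Di *m y by rewrite mulmxA (mulmx1C DDi) mul1mx.
  by rewrite mulrC -ler_pdivlMr // mulrC.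
(* [Qc] kills the leading part of the splitting of [A + dA]; only the trailing block acts on [x]. *)
have upper : vnorm2 ((A + dA) *m x) <= rdiag Dt k * vnorm2 c.
  rewrite (svd_split svdAt (ltnW kp) (ltnW kq)) mulmxDl /x.
  rewrite -!(mulmxA _ _ (lcols k.+1 Q *m c)) (mulmxA _ _ c) Qc !mulmx0 add0r.
  rewrite -mulmxA vnorm2_isometry //.
  apply: le_trans (opbound_trailing svdAt kpq _) _; rewrite ler_wpM2l // -xc.
  by rewrite -[leRHS]mul1r; exact: opbound_isometry_tr.
rewrite -(ler_pM2r (vnorm2_gt0 c0)); apply: le_trans lower _.
have -> : A *m x = (A + dA) *m x + dA *m (- x).
  by rewrite mulmxDl mulmxN addrK.
apply: le_trans (vnorm2D _ _) _; rewrite mulrDl lerD //.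
rewrite -xc; have -> : vnorm2 x = vnorm2 (- x) by rewrite -scaleN1r vnorm2Z normrN1 mul1r.
exact: opbound_specnorm.
Qed.

End SingularSubspaces.

(** * Coupled inequalities for the sines and their solution *)

Section Coupling.
Set Implicit Arguments.
Unset Strict Implicit.
Context {R : realType}.

Lemma specnorm_tr p q (M : 'M[R]_(p, q)) : specnorm M^T = specnorm M.
Proof.
have tr_le k l (N : 'M[R]_(k, l)) : specnorm N^T <= specnorm N.
  apply: specnorm_le; first exact: specnorm_ge0.
  by apply: opbound_tr; [exact: specnorm_ge0 | exact: opbound_specnorm].
by apply: le_anti; rewrite tr_le; have := tr_le _ _ M^T; rewrite trmxK.
Qed.

(** Solve the Sylvester equation as [X = (B *m Y + F) *m Di] and take norms. *)
Lemma specnorm_coupling p q r (X : 'M[R]_(p, r)) (Y : 'M[R]_(q, r)) (D Di : 'M[R]_r)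
    (B : 'M[R]_(p, q)) (F : 'M[R]_(p, r)) s b f :
  X *m D = B *m Y + F -> D *m Di = 1%:M -> 0 < s -> opbound Di s^-1 ->
  0 <= b -> opbound B b -> 0 <= f -> opbound F f ->
  s * specnorm X <= b * specnorm Y + f.
Proof.
move=> XD DDi s0 Dis b0 Bb f0 Ff; rewrite mulrC -ler_pdivlMr //.
have g0 : 0 <= b * specnorm Y + f by rewrite addr_ge0 ?mulr_ge0 ?specnorm_ge0.
apply: specnorm_le; first by rewrite mulr_ge0 // invr_ge0 ltW.
have -> : X = (B *m Y + F) *m Di by rewrite -XD -mulmxA DDi mulmx1.
apply: opboundM => //; apply: opboundD => //; apply: opboundM => //.
exact: opbound_specnorm.
Qed.

(** Only inequalities led by [x] are needed here: those led by [y] are the same statement for the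
    transposed matrices. *)
Lemma sin_coupling p q (A dA : 'M[R]_(p, q)) P D Q Pt Dt Qt r s :
  is_svd A P D Q -> is_svd (A + dA) Pt Dt Qt ->
  (0 < r)%N -> (r < minn p q)%N -> 0 < s -> s <= rdiag Dt r.-1 ->
  let x := specnorm ((rcols r P)^T *m lcols r Pt) in
  let y := specnorm ((rcols r Q)^T *m lcols r Qt) in
  s * x <= rdiag D r * y + specnorm dA /\
  s * x <= (rdiag D r + specnorm ((rcols r P)^T *m dA *m rcols r Q)) * y
           + specnorm ((rcols r P)^T *m dA *m lcols r Q).
Proof.
case: r => // r svdA svdAt _ rpq s0 sr /=.
have [rp rq] : (r.+1 <= p)%N /\ (r.+1 <= q)%N.
  by apply/andP; rewrite -leq_min; exact: ltnW.
have [Di DDi Dib] := leading_inverse svdAt (ltnW rpq) s0 sr.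
have [PP QQ _ _ _] := svdA; have [_ QtQt _ _ _] := svdAt.
have [_ P22 _ _] := cols_split PP rp; have [Q11 _ _ Qcover] := cols_split QQ rq.
have [Qt11 _ _ _] := cols_split QtQt rq.
have b0 := svd_rdiag_ge0 svdA rpq; have Sb := opbound_trailing svdA rpq.
set P2 := rcols r.+1 P; set Q2 := rcols r.+1 Q; set Q1 := lcols r.+1 Q.
set Pt1 := lcols r.+1 Pt; set Qt1 := lcols r.+1 Qt.
set S2 := diag_block D r.+1 _ _ in Sb.
have XD : P2^T *m Pt1 *m diag_block Dt 0 r.+1 r.+1
    = S2 *m (Q2^T *m Qt1) + P2^T *m dA *m Qt1.
  rewrite -mulmxA -(mul_lcols_svd svdAt) // !(mulmxDl, mulmxDr) !mulmxA.
  by rewrite (tr_rcols_mul_svd svdA).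
split.
  apply: specnorm_coupling XD DDi s0 Dib b0 Sb (specnorm_ge0 _) _.
  rewrite -[specnorm dA]mulr1 -[specnorm dA]mul1r.
  apply: opboundM; [by rewrite mul1r specnorm_ge0| |exact: opbound_isometry].
  by apply: opboundM => //; [exact: opbound_isometry_tr|exact: opbound_specnorm].
(* The perturbation through [Q2] joins the coefficient of [Q2^T *m Qt1]; only the part through [Q1]
   stays as a free term. *)
have XD' : P2^T *m Pt1 *m diag_block Dt 0 r.+1 r.+1
    = (S2 + P2^T *m dA *m Q2) *m (Q2^T *m Qt1) + P2^T *m dA *m Q1 *m (Q1^T *m Qt1).
  rewrite XD mulmxDl -addrA; congr (_ + _).
  by rewrite -!(mulmxA (P2^T *m dA)) -mulmxDr !(mulmxA _ _ Qt1) -mulmxDl addrC Qcover mul1mx.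
apply: specnorm_coupling XD' DDi s0 Dib _ _ (specnorm_ge0 _) _.
- by rewrite addr_ge0 ?specnorm_ge0.
- by apply: opboundD => //; exact: opbound_specnorm.
- rewrite -[specnorm _]mulr1; apply: opboundM; first exact: specnorm_ge0.
    exact: opbound_specnorm.
  rewrite -[1]mulr1; apply: opboundM => //; [exact: opbound_isometry_tr|exact: opbound_isometry].
Qed.

(** Add [s] times the first inequality to [b] times the second; the terms in [y] cancel. *)
Lemma coupled_le (s b x y f g : R) : 0 <= b -> 0 < s ->
  s * x <= b * y + f -> s * y <= b * x + g ->
  (s ^+ 2 - b ^+ 2) * x <= s * f + b * g.
Proof.
move=> b0 s0 h1 h2.
have := ler_wpM2l (ltW s0) h1; have := ler_wpM2l b0 h2.
rewrite !mulrDr (mulrCA s b) !mulrA -!expr2; lra.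
Qed.

(** The common factor [sr - d + sr1] cancels, leaving [(sr - d - sr1) * x <= d]; the gap condition
    gives [sr - sr1 <= 2 * (sr - d - sr1)]. *)
Lemma linear_gap_le (sr sr1 d x : R) : 0 <= sr1 -> 0 < sr - d ->
  2 * d < sr - sr1 -> 0 <= x ->
  ((sr - d) ^+ 2 - sr1 ^+ 2) * x <= (sr - d) * d + sr1 * d ->
  x * (sr - sr1) <= 2 * d.
Proof.
move=> b0 s0 gap x0; rewrite subr_sqr -mulrDl mulrAC (mulrC _ d).
rewrite ler_pM2r; last by lra.
have : x * (sr - sr1) <= x * (2 * (sr - d - sr1)) by rewrite ler_wpM2l //; lra.
lra.
Qed.

(* The left side dominates [x / 2 * (sr ^+ 2 - sr1 ^+ 2)], because
   [(sr - d) ^+ 2 - (sr1 + c) ^+ 2 >= (sr - sr1 - 2 * d) * (sr + sr1)];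
   the constant 8/3 could thus be lowered to 2. *)
Lemma quadratic_gap_le (sr sr1 d c x f g : R) :
  0 <= sr1 -> 0 <= c -> c <= d -> 0 <= f -> 0 <= g -> 0 < sr - sr1 ->
  4 * d <= sr - sr1 -> 0 <= x ->
  ((sr - d) ^+ 2 - (sr1 + c) ^+ 2) * x <= (sr - d) * f + (sr1 + c) * g ->
  x <= 8 / 3 * ((sr * f + sr1 * g + c * g) / (sr ^+ 2 - sr1 ^+ 2)).
Proof.
move=> b0 c0 cd f0 g0 gap small x0 h.
have G : 0 < sr ^+ 2 - sr1 ^+ 2 by nra.
have half : (sr ^+ 2 - sr1 ^+ 2) / 2 <= (sr - d) ^+ 2 - (sr1 + c) ^+ 2 by nra.
have N0 : 0 <= sr * f + sr1 * g + c * g by nra.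
rewrite mulrA ler_pdivlMr //.
have := ler_wpM2r x0 half; nra.
Qed.

End Coupling.

(** * Sine bounds for the left and right singular subspaces *)

Theorem theorem3p2 (R : realType) (n m r : nat)
    (A dA : 'M[R]_(n, m))
    (U : 'M[R]_n) (S : 'M[R]_(n, m)) (V : 'M[R]_m)
    (Ut : 'M[R]_n) (St : 'M[R]_(n, m)) (Vt : 'M[R]_m) :
  is_svd A U S V ->
  is_svd (A + dA) Ut St Vt ->
  (1 <= r)%N -> (r < minn n m)%N ->
  let sr := rdiag S r.-1 in   (* sigma_r *)
  let sr1 := rdiag S r in     (* sigma_{r+1} *)
  let U1 := lcols r U in let U2 := rcols r U in
  let V1 := lcols r V in let V2 := rcols r V in
  let Ut1 := lcols r Ut in let Vt1 := lcols r Vt in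
  let a12 := U1^T *m dA *m V2 in
  let a21 := U2^T *m dA *m V1 in
  let a22 := U2^T *m dA *m V2 in
  Num.max (specnorm (sinTheta U1 Ut1)) (specnorm (sinTheta V1 Vt1))
    <= (if sr == sr1 then 1
        else Num.min (2 * specnorm dA / (sr - sr1)) 1)
  /\
  (0 < sr - sr1 -> 4 * specnorm dA <= sr - sr1 ->
     specnorm (sinTheta U1 Ut1)
       <= 8 / 3 * ((sr * specnorm a21 + sr1 * specnorm a12
                    + specnorm a22 * specnorm a12) / (sr ^+ 2 - sr1 ^+ 2))
     /\
     specnorm (sinTheta V1 Vt1)
       <= 8 / 3 * ((sr * specnorm a12 + sr1 * specnorm a21
                    + specnorm a22 * specnorm a21) / (sr ^+ 2 - sr1 ^+ 2))).
Proof.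
move=> svdA svdAt r1 rnm sr sr1 U1 U2 V1 V2 Ut1 Vt1 a12 a21 a22.
have [rn rm] : (r <= n)%N /\ (r <= m)%N by apply/andP; rewrite -leq_min; exact: ltnW.
have predr : (r.-1 < minn n m)%N by exact: leq_ltn_trans (leq_pred r) rnm.
have [UU VV _ _ [_ dd]] := svdA; have [UtUt VtVt _ _ _] := svdAt.
have [_ _ _ Ucover] := cols_split UU rn; have [_ _ _ Vcover] := cols_split VV rm.
have [Ut11 _ _ _] := cols_split UtUt rn; have [Vt11 _ _ _] := cols_split VtVt rm.
pose d := specnorm dA; pose x := specnorm (U2^T *m Ut1); pose y := specnorm (V2^T *m Vt1).
have d0 : 0 <= d by exact: specnorm_ge0.
have x0 : 0 <= x by exact: specnorm_ge0.
have y0 : 0 <= y by exact: specnorm_ge0.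
have sinU : specnorm (sinTheta U1 Ut1) <= x.
  by apply: (specnorm_sinTheta_le Ucover) => //; exact: opbound_specnorm.
have sinV : specnorm (sinTheta V1 Vt1) <= y.
  by apply: (specnorm_sinTheta_le Vcover) => //; exact: opbound_specnorm.
have sr10 : 0 <= sr1 by exact: (svd_rdiag_ge0 svdA rnm).
have sr1_le : sr1 <= sr by apply: dd => //; exact: leq_pred.
have weyl : sr - d <= rdiag St r.-1.
  by rewrite lerBlDr; exact: (singular_value_perturbation svdA svdAt predr).
(* A gap above [2 * d] makes [sr - d] positive, hence by [weyl] a valid lower bound for the leading
   singular values of [A + dA]. *)
have coupling : 2 * d < sr - sr1 ->
  [/\ (sr - d) * x <= sr1 * y + d, (sr - d) * y <= sr1 * x + d,
      (sr - d) * x <= (sr1 + specnorm a22) * y + specnorm a21 &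
      (sr - d) * y <= (sr1 + specnorm a22) * x + specnorm a12].
  move=> gap; have s0 : 0 < sr - d by clear -gap d0 sr10; lra.
  have [hx1 hx2] := sin_coupling svdA svdAt r1 rnm s0 weyl.
  (* In the transposed problem [a12^T] takes the place of [a21], and [a22^T] that of [a22], with the
     same norm. *)
  have svdAtT := is_svd_tr svdAt; rewrite linearD /= in svdAtT.
  have weylT : sr - d <= rdiag St^T r.-1 by rewrite /rdiag mxe_tr.
  have rmn : (r < minn m n)%N by rewrite minnC.
  have [hy1 hy2] := sin_coupling (is_svd_tr svdA) svdAtT r1 rmn s0 weylT.
  have a22T : V2^T *m dA^T *m U2 = a22^T by rewrite /a22 !trmx_mul trmxK mulmxA.
  have a12T : V2^T *m dA^T *m U1 = a12^T by rewrite /a12 !trmx_mul trmxK mulmxA.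
  split=> //; first by move: hy1; rewrite /rdiag mxe_tr specnorm_tr.
  by move: hy2; rewrite /rdiag mxe_tr -/U1 -/U2 -/V2 a22T a12T !specnorm_tr.
split; last first.
  move=> gap; rewrite -/d => small; have d2 : 2 * d < sr - sr1 by clear -gap small d0 sr10; lra.
  have [_ _ hx hy] := coupling d2.
  have c0 : 0 <= specnorm a22 by exact: specnorm_ge0.
  (* Compression by orthonormal columns does not increase the norm. *)
  have cd : specnorm a22 <= d.
    apply: specnorm_le => //; rewrite -[d]mulr1 -[d]mul1r.
    have [_ U22 _ _] := cols_split UU rn; have [_ V22 _ _] := cols_split VV rm.
    apply: opboundM; [by rewrite mul1r| |exact: opbound_isometry].
    by apply: opboundM => //; [exact: opbound_isometry_tr|exact: opbound_specnorm].
  have s0 : 0 < sr - d by clear -gap small d0 sr10; lra.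
  have b0 : 0 <= sr1 + specnorm a22 by rewrite addr_ge0.
  split.
    apply: le_trans sinU _.
    apply: (quadratic_gap_le sr10 c0 cd _ _ gap small x0); try exact: specnorm_ge0.
    exact: coupled_le hx hy.
  apply: le_trans sinV _.
  apply: (quadratic_gap_le sr10 c0 cd _ _ gap small y0); try exact: specnorm_ge0.
  exact: coupled_le hy hx.
have maxle (a b c : R) : a <= c -> b <= c -> Num.max a b <= c.
  by move=> ac bc; rewrite ge_max ac bc.
have max1 := maxle _ _ 1 (specnorm_sinTheta_le1 U1 Ut1) (specnorm_sinTheta_le1 V1 Vt1).
have [//|neq] := eqVneq sr sr1.
have gap : 0 < sr - sr1 by rewrite subr_gt0 lt_def neq.
rewrite le_min max1 andbT.
(* If [2 * d] is at least the gap, the quotient is at least 1 and the trivial bound [max1]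
   suffices. *)
have [big|small] := leP (sr - sr1) (2 * d).
  by apply: le_trans max1 _; rewrite ler_pdivlMr // mul1r.
have [hx hy _ _] := coupling small.
have s0 : 0 < sr - d by clear -gap small d0 sr10; lra.
have boundx := linear_gap_le sr10 s0 small x0 (coupled_le sr10 s0 hx hy).
have boundy := linear_gap_le sr10 s0 small y0 (coupled_le sr10 s0 hy hx).
apply: maxle; rewrite ler_pdivlMr //.
  by apply: le_trans boundx; rewrite ler_pM2r.
by apply: le_trans boundy; rewrite ler_pM2r.
Qed.
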